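(* Let $(y_n)_{n\ge1}$ be nonnegative and nonincreasing with $y_n\to0$, set $\lambda_M=y_M-y_{M+1}\ge0$ for $M\ge1$, and fix an integer $J_0\ge1$ such that $\lambda_M=0$ for $M<J_0$. Put $$L_k=\sum_{M=2^kJ_0}^{2^{k+1}J_0-1}\lambda_M\qquad(k\ge0),$$ and suppose that $$L_{k+1}\le\frac1{1900}L_k\qquad(k\ge0).$$ Put $x_n=n^{-3/2}y_n$. Then $A<\infty$, $E_3<\infty$, and $\mathcal C(x)<2AE_3$ unless $y=0$. More quantitatively, $$AE_3-\frac12\mathcal C(x)\ge\frac{\sqrt{J_0}}{600}\sum_{k\ge0}2^{k/2}L_k^3.$$
   Context: For a nonnegative sequence $x=(x_n)_{n\ge1}$, $$A=\sum_{n\ge1}x_n,\qquad E_3=\sum_{n\ge1}n^3x_n^2,\qquad \mathcal C(x)=\sum_{a,b\ge1}(a+b)(a^2+ab+b^2)x_ax_bx_{a+b}.$$ *)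

(* Defs.v *)
From HB Require Import structures.
From mathcomp Require Import all_boot all_order all_algebra.
From mathcomp Require Import all_classical all_reals all_analysis.
Set Implicit Arguments.
Unset Strict Implicit.
Unset Printing Implicit Defensive.
Import Order.TTheory GRing.Theory Num.Theory.
Import numFieldNormedType.Exports.
Local Open Scope classical_set_scope.
Local Open Scope ring_scope.

(* Sequences indexed by n >= 1 are functions on nat whose value at 0 is never
   used. The sums below are meant for sequences that are nonnegative on n >= 1
   and are [\bar R]-valued, so that finiteness is not built in. *)

Definition sumA (R : realType) (x : nat -> R) : \bar R :=
  (\sum_(1 <= n <oo) (x n)%:E)%E.

Definition sumE3 (R : realType) (x : nat -> R) : \bar R :=
  (\sum_(1 <= n <oo) (n%:R ^+ 3 * x n ^+ 2)%:E)%E.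

Definition sumC (R : realType) (x : nat -> R) : \bar R :=
  (\esum_(p in [set p : nat * nat | (1 <= p.1)%N /\ (1 <= p.2)%N])
    ((p.1%:R + p.2%:R) * (p.1%:R ^+ 2 + p.1%:R * p.2%:R + p.2%:R ^+ 2)
      * x p.1 * x p.2 * x (p.1 + p.2)%N)%:E)%E.

Definition lambda (R : realType) (y : nat -> R) (M : nat) : R :=
  y M - y M.+1.

Definition blockL (R : realType) (y : nat -> R) (J0 k : nat) : R :=
  \sum_(2 ^ k * J0 <= M < 2 ^ k.+1 * J0) lambda y M.

Definition xseq (R : realType) (y : nat -> R) (n : nat) : R :=
  n%:R `^ (- (3 / 2)) * y n.

(* Main.v *)
Require Import Defs.
From HB Require Import structures.
From mathcomp Require Import all_boot all_order all_algebra.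
From mathcomp Require Import all_classical all_reals all_analysis.
From mathcomp Require Import ring lra zify.
Import Order.TTheory GRing.Theory Num.Theory.
Import numFieldNormedType.Exports.
Local Open Scope classical_set_scope.
Local Open Scope ring_scope.
Set Implicit Arguments.
Unset Strict Implicit.

(** The sequence is a superposition of sharp cutoffs, y_n = sum of lambda_Q
    over Q >= n, so that A E_3 and C/2 become trilinear in lambda, one index per
    factor of y.  Two observations control their difference.

    First, by the symmetry of C in its two free indices,
      C/2 = sum_b b^{-3/2} y_b sum_a f_b'(a) y_a y_{a+b},
      f_b(t) = sqrt (t (t + b)),
    and f_b is concave with f_b(0) = 0, so a sum of f_b' over 1..m is at most
    f_b(m) ([slope_le_step], [pairSum_le]).  On the other side, A E_3 is
    sum_b b^{-3/2} y_b sum_a y_a^2.  It remains, for each b, to compare the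
    two sums over a.

    Second, for cutoffs Q <= Q', the sum of y_a^2 contributes 2 Q for the two
    orderings of the pair, while the sum of f_b'(a) y_a y_{a+b} contributes at
    most f_b(Q) + f_b(Q - b) = sqrt (Q (Q + b)) + sqrt (Q (Q - b)).  When b <= Q
    this is less than 2 Q by at least b^2 / (4 Q), by concavity of the square root.  When
    b > Q only f_b(Q) survives, and it exceeds 2 Q only for b > 3 Q, by less
    than b / 2, and then only if b <= Q' ([pairSum_sym_le]).

    Three cutoffs in one dyadic block k therefore gain at least
    sqrt (2^k J) / 32 per unit of L_k^3 ([block_cube_le], [finite_gap]).  The
    losses involve only b >= 2 J and add up to at most
    y_1 / 2 times the sum of y_b^2 / sqrt b over b >= 2 J.  The decay of the L_k
    makes y_b tiny there, so that the losses are below sqrt J L_0^3 / 100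
    ([loss_le]); they are paid out of the gain of block 0, because
    1/32 > 1/100 + 1/600 ([finite_bound]).

    All this is done for the truncations y_n - y_N with N = 2^K J, where the
    sums are finite; [partial_bound] lets K tend to infinity for a fixed finite
    part of C, and the supremum over such parts gives the theorem. *)

(** * The concave profile and pairs of cutoffs *)

(** The derivative at [a] of [t |-> sqrt (t * (t + b))]. *)
Definition slope (R : realType) (b a : nat) : R :=
  (a%:R + b%:R / 2) / Num.sqrt (a%:R * (a%:R + b%:R)).

Lemma slope_ge0 (R : realType) b a : 0 <= slope R b a.
Proof. by rewrite divr_ge0 ?sqrtr_ge0 // addr_ge0 ?divr_ge0. Qed.

(** Concavity: the tangent at the right end of a unit step lies above the
    graph.  After multiplying by the larger root and squaring, the two sides
    differ by [b ^ 2 / 4]. *)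
Lemma slope_le_step (R : realType) (b m : nat) : (1 <= b)%N ->
  Num.sqrt (m%:R * (m%:R + b%:R)) + slope R b m.+1
  <= Num.sqrt (m.+1%:R * (m.+1%:R + b%:R)).
Proof.
move=> b1; rewrite /slope.
set t := Num.sqrt (m.+1%:R * _); set s := Num.sqrt _.
have hb : 1 <= b%:R :> R by rewrite ler1n.
have hm : 0 <= m%:R :> R by [].
have hm1 : m.+1%:R = m%:R + 1 :> R by rewrite -natr1.
have t2 : t ^+ 2 = (m%:R + 1) * (m%:R + 1 + b%:R).
  by rewrite /t sqr_sqrtr hm1 //; nra.
have s2 : s ^+ 2 = m%:R * (m%:R + b%:R) by rewrite /s sqr_sqrtr //; nra.
have t0 : 0 < t by rewrite /t sqrtr_gt0 hm1; nra.
have s0 : 0 <= s by exact: sqrtr_ge0.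
rewrite -lerBrDr -(ler_pM2r t0) mulrBl divfK ?gt_eqF // -expr2 hm1.
rewrite -ler_sqr ?nnegrE ?mulr_ge0 // ?(ltW t0) //; last by nra.
rewrite exprMn s2 t2; nra.
Qed.

(** What the layers [Q] of the first factor and [Q'] of the second contribute to
    the sum of [slope b a * y a * y (a + b)]. *)
Definition pairSum (R : realType) (N b Q Q' : nat) : R :=
  \sum_(1 <= a < N) slope R b a * ((a <= Q)%N && (a + b <= Q')%N)%:R.

(** The terms present have [a <= m], so the concavity steps telescope from
    [0] to at most [m]. *)
Lemma pairSum_le (R : realType) (N b Q Q' m : nat) : (1 <= b)%N ->
  (forall a, (1 <= a)%N -> (a <= Q)%N -> (a + b <= Q')%N -> (a <= m)%N) ->
  pairSum R N b Q Q' <= Num.sqrt (m%:R * (m%:R + b%:R)).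
Proof.
move=> b1 hm.
have mono k : (k <= m)%N ->
    Num.sqrt (k%:R * (k%:R + b%:R) : R) <= Num.sqrt (m%:R * (m%:R + b%:R)).
  by move=> km; apply: ler_wsqrtr; apply: ler_pM; rewrite ?addr_ge0 ?lerD2r ?ler_nat.
case: N => [|N]; first by rewrite /pairSum big_geq // sqrtr_ge0.
suff h : pairSum R N.+1 b Q Q'
    <= Num.sqrt ((minn N m)%:R * ((minn N m)%:R + b%:R)).
  by apply: (le_trans h); apply: mono; rewrite geq_minr.
rewrite /pairSum; elim: N => [|N IH]; first by rewrite big_geq // sqrtr_ge0.
rewrite big_nat_recr //=; case: (leqP N.+1 m) => Nm.
- apply: le_trans (slope_le_step R N b1); apply: lerD.
    by move: IH; rewrite (minn_idPl (ltnW Nm)).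
  by rewrite ler_piMr ?slope_ge0 ?lern1 ?leq_b1.
- case: (boolP (_ && _)) => [/andP[h1 h2]|_].
    by have := hm N.+1 isT h1 h2; lia.
  by rewrite mulr0 addr0; move: IH; rewrite (minn_idPr _).
Qed.

(** Exchanging the layers is essential: for [b <= Q] the bound
    [sqrt (Q (Q + b))] on the first term exceeds [Q], and it is the shift by
    [- b] in the exchanged term that compensates.  The excess over [2 Q] is
    possible only for [b > 3 Q], since [sqrt (Q (Q + b)) <= 2 Q] otherwise. *)
Lemma pairSum_sym_le_ord (R : realType) (N b Q Q' : nat) :
  (1 <= b)%N -> (1 <= Q)%N -> (Q <= Q')%N ->
  pairSum R N b Q Q' + pairSum R N b Q' Q
  <= 2 * Q%:R - (b <= Q)%N%:R * (b%:R ^+ 2 / (4 * Q%:R))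
     + ((3 * Q < b)%N && (b <= Q')%N)%:R * (b%:R / 2).
Proof.
move=> b1 Q1 QQ'.
have hb : 1 <= b%:R :> R by rewrite ler1n.
have hQ : 1 <= Q%:R :> R by rewrite ler1n.
have hl : pairSum R N b Q Q' <= Num.sqrt (Q%:R * (Q%:R + b%:R)).
  by apply: pairSum_le.
have hl0 : (Q < b)%N -> pairSum R N b Q' Q <= 0.
  move=> Qb; apply: le_trans (@pairSum_le R N b Q' Q 0 b1 _) _; first by lia.
  by rewrite mul0r sqrtr0.
case: (leqP b Q) => bQ.
- have -> : (3 * Q < b)%N = false by lia.
  rewrite mul0r addr0 mul1r.
  have hr : pairSum R N b Q' Q <= Num.sqrt ((Q - b)%:R * ((Q - b)%:R + b%:R)).
    by apply: pairSum_le => // a; lia.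
  apply: le_trans (lerD hl hr) _; rewrite natrB // subrK.
  have hbQ : b%:R <= Q%:R :> R by rewrite ler_nat.
  set q : R := Q%:R in hQ hbQ *; set c : R := b%:R in hb hbQ *.
  set s := Num.sqrt _; set t := Num.sqrt _.
  have s0 : 0 <= s by exact: sqrtr_ge0.
  have t0 : 0 <= t by exact: sqrtr_ge0.
  have s2 : s ^+ 2 = q * (q + c) by rewrite /s sqr_sqrtr //; nra.
  have t2 : t ^+ 2 = (q - c) * q by rewrite /t sqr_sqrtr //; nra.
  have st : s * t <= q ^+ 2 - c ^+ 2 / 2.
    rewrite -ler_sqr ?nnegrE ?mulr_ge0 //; last by nra.
    by rewrite exprMn s2 t2; nra.
  (* a lower bound for 2 q - sqrt (q (q + c)) - sqrt (q (q - c)) *)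
  pose d := c ^+ 2 / (4 * q).
  have dE : d * q = c ^+ 2 / 4 by rewrite /d; field; lra.
  have d0 : 0 <= d by rewrite /d divr_ge0 ?sqr_ge0 //; lra.
  have dq : d <= q.
    by rewrite -(@ler_pM2r _ q) ?dE; [nra|lra].
  rewrite -/d -ler_sqr ?nnegrE ?(addr_ge0 s0 t0) //; last by lra.
  by rewrite sqrrD s2 t2; nra.
- have := hl0 bQ; rewrite mul0r subr0.
  case: (leqP b Q') => bQ'; last first.
    rewrite andbF mul0r addr0 => h0.
    suff h : pairSum R N b Q Q' <= 0 by lra.
    apply: le_trans (@pairSum_le R N b Q Q' 0 b1 _) _; first by lia.
    by rewrite mul0r sqrtr0.
  rewrite andbT; move: hl; set s := Num.sqrt _ => hl h0.
  have s0 : 0 <= s by exact: sqrtr_ge0.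
  have s2 : s ^+ 2 = Q%:R * (Q%:R + b%:R) by rewrite /s sqr_sqrtr //; nra.
  case: (leqP b (3 * Q)) => b3.
    have hb3 : b%:R <= 3 * Q%:R :> R by rewrite -natrM ler_nat.
    have : s <= 2 * Q%:R by rewrite -ler_sqr ?nnegrE ?mulr_ge0 // s2; nra.
    by rewrite mul0r; lra.
  have : s <= Q%:R + b%:R / 2 by rewrite -ler_sqr ?nnegrE ?s2 //; nra.
  by rewrite mul1r; lra.
Qed.

(** The condition [b <= max] on the excess is relaxed to a sum of one indicator per
    layer, so that after summation over pairs of layers the loss is the product
    [tail l N 1 * tail l N b]. *)
Lemma pairSum_sym_le (R : realType) (N b Q Q' : nat) :
  (1 <= b)%N -> (1 <= Q)%N -> (1 <= Q')%N ->
  pairSum R N b Q Q' + pairSum R N b Q' Q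
  <= 2 * (minn Q Q')%:R
     - ((b <= Q)%N && (b <= Q')%N)%:R * (b%:R ^+ 2 / (4 * (minn Q Q')%:R))
     + (3 * minn Q Q' < b)%N%:R * ((b <= Q)%N%:R + (b <= Q')%N%:R) * (b%:R / 2).
Proof.
move=> b1; wlog QQ' : Q Q' / (Q <= Q')%N => [hw Q1 Q1'|Q1 _].
  case: (leqP Q Q') => h; first by have := hw _ _ h Q1 Q1'; rewrite (minn_idPl h).
  have := hw _ _ (ltnW h) Q1' Q1.
  by rewrite minnC (minn_idPr (ltnW h)) [in X in X -> _]addrC andbC
     [X in _ * X * (b%:R / 2)]addrC.
rewrite (minn_idPl QQ'); apply: le_trans (pairSum_sym_le_ord R N b1 Q1 QQ') _.
have -> : (b <= Q)%N && (b <= Q')%N = (b <= Q)%N by lia.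
rewrite lerD2l ler_wpM2r ?divr_ge0 // -mulnb natrM ler_wpM2l // ?lerDr //.
Qed.

(** * Finite superpositions of cutoffs *)

Definition tail (R : realType) (l : nat -> R) (N n : nat) : R :=
  \sum_(n <= M < N) l M.

Definition layerSum (R : realType) (l : nat -> R) (N : nat)
    (c : nat -> nat -> R) : R :=
  \sum_(1 <= Q < N) \sum_(1 <= Q' < N) l Q * l Q' * c Q Q'.

Lemma tail_indicator (R : realType) (l : nat -> R) N n : (1 <= n)%N ->
  tail l N n = \sum_(1 <= M < N) l M * (n <= M)%N%:R.
Proof.
move=> n1; rewrite /tail (big_nat_widenl _ 1) // big_mkcond /=.
by apply: eq_bigr => M _; case: (n <= M)%N; rewrite ?mulr1 ?mulr0.
Qed.

Lemma tail_ge0 (R : realType) (l : nat -> R) N n : (1 <= n)%N ->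
  (forall M, (1 <= M)%N -> 0 <= l M) -> 0 <= tail l N n.
Proof.
move=> n1 l0; rewrite /tail big_nat_cond; apply: sumr_ge0 => M /andP[/andP[nM _] _].
by apply: l0; exact: leq_trans nM.
Qed.

Lemma layerSum_prod (R : realType) (l : nat -> R) N (p q : nat -> R) :
  (\sum_(1 <= Q < N) l Q * p Q) * (\sum_(1 <= Q < N) l Q * q Q)
  = layerSum l N (fun Q Q' => p Q * q Q').
Proof.
rewrite big_distrlr; apply: eq_bigr => Q _; apply: eq_bigr => Q' _.
by rewrite mulrACA.
Qed.

Lemma layerSum_sym (R : realType) (l : nat -> R) N c :
  layerSum l N c = layerSum l N (fun Q Q' => c Q' Q).
Proof.
rewrite /layerSum exchange_big; apply: eq_bigr => Q _; apply: eq_bigr => Q' _.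
by rewrite (mulrC (l Q')).
Qed.

Lemma layerSumD (R : realType) (l : nat -> R) N c d :
  layerSum l N (fun Q Q' => c Q Q' + d Q Q') = layerSum l N c + layerSum l N d.
Proof.
rewrite /layerSum -big_split; apply: eq_bigr => Q _.
by rewrite -big_split; apply: eq_bigr => Q' _; rewrite mulrDr.
Qed.

Lemma layerSumZ (R : realType) (l : nat -> R) N (a : R) c :
  layerSum l N (fun Q Q' => a * c Q Q') = a * layerSum l N c.
Proof.
rewrite /layerSum mulr_sumr; apply: eq_bigr => Q _.
by rewrite mulr_sumr; apply: eq_bigr => Q' _; rewrite mulrCA.
Qed.

Lemma layerSum_sum (R : realType) (l : nat -> R) N m n (c : nat -> nat -> nat -> R) :
  \sum_(m <= i < n) layerSum l N (c i)
  = layerSum l N (fun Q Q' => \sum_(m <= i < n) c i Q Q').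
Proof.
rewrite /layerSum exchange_big; apply: eq_bigr => Q _.
by rewrite exchange_big; apply: eq_bigr => Q' _; rewrite mulr_sumr.
Qed.

Lemma layerSum_le (R : realType) (l : nat -> R) N c d :
  (forall M, (1 <= M)%N -> 0 <= l M) ->
  (forall Q Q', (1 <= Q < N)%N -> (1 <= Q' < N)%N ->
     l Q != 0 -> l Q' != 0 -> c Q Q' <= d Q Q') ->
  layerSum l N c <= layerSum l N d.
Proof.
move=> l0 cd; rewrite /layerSum; apply: ler_sum_nat => Q hQ.
apply: ler_sum_nat => Q' hQ'.
have [->|nQ] := eqVneq (l Q) 0; first by rewrite !mul0r.
have [->|nQ'] := eqVneq (l Q') 0; first by rewrite mulr0 !mul0r.
have /andP[Q1 _] := hQ; have /andP[Q1' _] := hQ'.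
by apply: ler_wpM2l; [rewrite mulr_ge0 ?l0 | exact: cd].
Qed.

Lemma sum_indicator_le (R : realType) (N u : nat) : (u < N)%N ->
  \sum_(1 <= a < N) ((a <= u)%N%:R : R) = u%:R.
Proof.
move=> uN; rewrite (big_cat_nat _ (n := u.+1)) //=.
rewrite [X in _ + X]big_nat_cond [X in _ + X]big1 ?addr0; last first.
  by move=> a /andP[/andP[ua _] _]; rewrite leqNgt ua.
rewrite (eq_big_nat _ _ (F2 := fun=> 1)); last first.
  by move=> a /andP[_]; rewrite ltnS => ->.
by rewrite sumr_const_nat subn1.
Qed.

Definition gainKernel (R : realType) (b Q Q' : nat) : R :=
  ((b <= Q)%N && (b <= Q')%N)%:R / (minn Q Q')%:R.

(** The pair inequality summed over all pairs of layers.  Layers below [J] are empty,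
    so a loss forces [b > 3 J]; it is recorded under the weaker [b >= 2 J]. *)
Lemma slope_sum_le (R : realType) (l : nat -> R) (N J b : nat) :
  (1 <= b)%N -> (forall M, (1 <= M)%N -> 0 <= l M) ->
  (forall M, (1 <= M < J)%N -> l M = 0) ->
  \sum_(1 <= a < N) slope R b a * (tail l N a * tail l N (a + b))
    + b%:R ^+ 2 / 8 * layerSum l N (gainKernel R b)
  <= \sum_(1 <= a < N) tail l N a ^+ 2
     + (2 * J <= b)%N%:R * (b%:R / 2 * (tail l N 1 * tail l N b)).
Proof.
move=> b1 l0 lJ.
pose Kf := pairSum R N b.
have E1 : \sum_(1 <= a < N) slope R b a * (tail l N a * tail l N (a + b))
    = layerSum l N Kf.
  rewrite /Kf /pairSum -layerSum_sum; apply: eq_big_nat => a /andP[a1 _].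
  rewrite layerSumZ !tail_indicator ?(leq_trans a1) ?leq_addr //.
  congr (_ * _); rewrite layerSum_prod; apply: eq_bigr => Q _; apply: eq_bigr => Q' _.
  by rewrite -mulnb natrM.
have E2 : \sum_(1 <= a < N) tail l N a ^+ 2
    = layerSum l N (fun Q Q' => (minn Q Q')%:R).
  transitivity (layerSum l N (fun Q Q' =>
      \sum_(1 <= a < N) (a <= Q)%N%:R * (a <= Q')%N%:R : R)).
    rewrite -layerSum_sum; apply: eq_big_nat => a /andP[a1 _].
    by rewrite expr2 tail_indicator // layerSum_prod.
  apply: eq_big_nat => Q hQ; apply: eq_big_nat => Q' hQ'; congr (_ * _).
  rewrite -(@sum_indicator_le R N); last by lia.
  by apply: eq_bigr => a _; rewrite -natrM mulnb leq_min.
have E3 : tail l N 1 * tail l N b = layerSum l N (fun _ Q' => (b <= Q')%N%:R).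
  rewrite !tail_indicator // layerSum_prod; apply: eq_big_nat => Q hQ.
  by apply: eq_bigr => Q' _; have -> : (1 <= Q)%N by [lia]; rewrite mul1r.
rewrite -(@ler_pM2l _ 2) // !mulrDr.
have -> : 2 * (\sum_(1 <= a < N) slope R b a * (tail l N a * tail l N (a + b)))
   = layerSum l N (fun Q Q' => Kf Q Q' + Kf Q' Q).
  by rewrite E1 layerSumD [X in _ + X]layerSum_sym mulr_natl mulr2n.
have -> : 2 * ((2 * J <= b)%N%:R * (b%:R / 2 * (tail l N 1 * tail l N b)))
   = layerSum l N (fun Q Q' => (2 * J <= b)%N%:R * (b%:R / 2)
        * ((b <= Q)%N%:R + (b <= Q')%N%:R)).
  rewrite layerSumZ layerSumD [X in _ * (X + _)]layerSum_sym -E3.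
  by ring.
rewrite E2 -!layerSumZ -!layerSumD; apply: layerSum_le => //.
move=> Q Q' hQ hQ' nQ nQ'.
have hJ M : (1 <= M < N)%N -> l M != 0 -> (J <= M)%N.
  move=> hM; rewrite leqNgt; apply: contraNN => MJ; apply/eqP/lJ.
  by move: hM => /andP[-> _].
have JQ := hJ _ hQ nQ; have JQ' := hJ _ hQ' nQ'.
have Q1 : (1 <= Q)%N by lia.
have Q1' : (1 <= Q')%N by lia.
have := pairSum_sym_le R N b1 Q1 Q1'; rewrite -/Kf /gainKernel.
set m := minn Q Q' => h.
have m0 : m%:R != 0 :> R by rewrite pnatr_eq0; lia.
(* layers with nonzero weight are >= J, so 3 m < b implies 2 J <= b *)
have h3 : (3 * m < b)%N%:R * ((b <= Q)%N%:R + (b <= Q')%N%:R) * (b%:R / 2)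
   <= (2 * J <= b)%N%:R * (b%:R / 2) * ((b <= Q)%N%:R + (b <= Q')%N%:R) :> R.
  rewrite [X in _ <= X]mulrAC ler_wpM2r ?divr_ge0 // ler_wpM2r ?addr_ge0 //.
  case: (ltnP (3 * m) b) => // mb.
  by have -> : (2 * J <= b)%N by lia.
have -> : 2 * (b%:R ^+ 2 / 8 * (((b <= Q)%N && (b <= Q')%N)%:R / m%:R))
   = ((b <= Q)%N && (b <= Q')%N)%:R * (b%:R ^+ 2 / (4 * m%:R)) :> R.
  by field.
by lra.
Qed.

(** [blockL y J] is [block (lambda y) J]; here the weights are arbitrary. *)
Definition block (R : realType) (l : nat -> R) (J k : nat) : R :=
  \sum_(2 ^ k * J <= M < 2 ^ k.+1 * J) l M.

Definition inBlock (J k M : nat) : bool :=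
  (2 ^ k * J <= M)%N && (M < 2 ^ k.+1 * J)%N.

(** The blocks are disjoint, which shows up as a telescoping sum of
    indicators of [M < 2 ^ k * J]. *)
Lemma sum_inBlock_le (R : realType) (J K M : nat) :
  \sum_(0 <= k < K) ((inBlock J k M)%:R : R) <= 1.
Proof.
rewrite (eq_bigr (fun k => (M < 2 ^ k.+1 * J)%N%:R - (M < 2 ^ k * J)%N%:R : R)).
  rewrite telescope_sumr // lerBlDr; case: (_ < 2 ^ K * J)%N => //=.
    by rewrite lerDl.
  by rewrite addr_ge0.
move=> k _; rewrite /inBlock.
have h : (2 ^ k * J <= 2 ^ k.+1 * J)%N by rewrite leq_mul2r leq_exp2l ?leqnSn ?orbT.
case: (leqP (2 ^ k * J) M) => h1 /=; first by rewrite subr0.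
by rewrite (leq_trans h1 h) subrr.
Qed.

Lemma block_ge0 (R : realType) (l : nat -> R) J k : (1 <= J)%N ->
  (forall M, (1 <= M)%N -> 0 <= l M) -> 0 <= block l J k.
Proof.
move=> J1 l0; rewrite /block big_nat_cond; apply: sumr_ge0 => M /andP[/andP[h _] _].
by apply: l0; apply: leq_trans h; rewrite muln_gt0 expn_gt0.
Qed.

Lemma block_le_tail (R : realType) (l : nat -> R) J K k b :
  (1 <= b)%N -> (k < K)%N -> (b <= 2 ^ k * J)%N ->
  (forall M, (1 <= M)%N -> 0 <= l M) -> block l J k <= tail l (2 ^ K * J) b.
Proof.
move=> b1 kK bk l0; rewrite /block /tail.
have h1 : (2 ^ k * J <= 2 ^ k.+1 * J)%N by rewrite leq_mul2r leq_exp2l ?leqnSn ?orbT.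
have h2 : (2 ^ k.+1 * J <= 2 ^ K * J)%N by rewrite leq_mul2r leq_exp2l ?kK ?orbT.
rewrite [leRHS](big_cat_nat _ (n := 2 ^ k * J)%N) //= ?(leq_trans h1) //.
rewrite [X in _ <= _ + X](big_cat_nat _ (n := 2 ^ k.+1 * J)%N) //=.
have := tail_ge0 (2 ^ k * J) b1 l0; rewrite /tail => t1.
have : 0 <= tail l (2 ^ K * J) (2 ^ k.+1 * J).
  apply: tail_ge0 => //; apply: leq_trans b1 _; exact: leq_trans h1.
by rewrite /tail => t2; lra.
Qed.

(** Only triples of layers lying in the same block are kept: one factor [block k]
    is bounded by the tail at [b], the other two give a square of pairs with
    minimum below [2 ^ k.+1 * J], and these squares are disjoint. *)
Lemma block_cube_le (R : realType) (l : nat -> R) (J K b : nat) :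
  (1 <= b)%N -> (forall M, (1 <= M)%N -> 0 <= l M) -> (1 <= J)%N ->
  \sum_(0 <= k < K) (b <= 2 ^ k * J)%N%:R * (block l J k ^+ 3 / (2 ^ k.+1 * J)%:R)
  <= tail l (2 ^ K * J) b * layerSum l (2 ^ K * J) (gainKernel R b).
Proof.
move=> b1 l0 J1; set N := (2 ^ K * J)%N.
have Bsq k : (k < K)%N -> block l J k ^+ 2
    = layerSum l N (fun Q Q' => (inBlock J k Q)%:R * (inBlock J k Q')%:R).
  move=> kK; rewrite expr2 -layerSum_prod.
  suff -> : block l J k = \sum_(1 <= Q < N) l Q * (inBlock J k Q)%:R by [].
  have h1 : (1 <= 2 ^ k * J)%N by rewrite muln_gt0 expn_gt0.
  have h2 : (2 ^ k.+1 * J <= N)%N by rewrite leq_mul2r leq_exp2l ?kK ?orbT.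
  rewrite /block (big_nat_widen _ _ N) // (big_nat_widenl _ 1) // big_mkcond /=.
  apply: eq_bigr => M _; rewrite /inBlock andbC.
  by case: (_ && _); rewrite ?mulr1 ?mulr0.
apply: (@le_trans _ _ (\sum_(0 <= k < K) tail l N b *
    layerSum l N (fun Q Q' => (b <= 2 ^ k * J)%N%:R / (2 ^ k.+1 * J)%:R *
      ((inBlock J k Q)%:R * (inBlock J k Q')%:R)))).
  apply: ler_sum_nat => k /andP[_ kK].
  rewrite layerSumZ -Bsq // exprS.
  case: (leqP b (2 ^ k * J)) => bk; last by rewrite !mul0r mulr0.
  rewrite !mul1r -mulrA [_^-1 * _]mulrC ler_wpM2r //; last exact: block_le_tail.
  by rewrite divr_ge0 ?exprn_ge0 ?block_ge0.
rewrite -mulr_sumr ler_wpM2l ?tail_ge0 // layerSum_sum.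
apply: layerSum_le => // Q Q' hQ hQ' _ _.
apply: (@le_trans _ _ (\sum_(0 <= k < K) (inBlock J k Q)%:R * gainKernel R b Q Q')).
  apply: ler_sum_nat => k _; rewrite /gainKernel.
  case: (boolP (inBlock J k Q)) => [/andP[h1 h2]|_]; last by rewrite !mul0r mulr0.
  case: (boolP (inBlock J k Q')) => [/andP[h3 h4]|_]; last first.
    by rewrite !mulr0 mul1r divr_ge0.
  have [hb|hb] := leqP b (2 ^ k * J); last by rewrite !mul0r mul1r divr_ge0.
  rewrite (leq_trans hb h1) (leq_trans hb h3) /= !mul1r mulr1.
  have m1 : (1 <= minn Q Q')%N.
    by rewrite leq_min (leq_trans b1 (leq_trans hb h1)) (leq_trans b1 (leq_trans hb h3)).
  rewrite lef_pV2 ?posrE ?ltr0n ?muln_gt0 ?expn_gt0 // ler_nat.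
  by rewrite geq_min (ltnW h2).
rewrite -mulr_suml ler_piMl ?sum_inBlock_le //.
by rewrite /gainKernel divr_ge0.
Qed.

(** From [sqrt b >= b / sqrt m] for [b <= m] and the sum of an arithmetic
    progression. *)
Lemma sum_sqrt_ge (R : realType) (m : nat) :
  m%:R * Num.sqrt m%:R / 2 <= \sum_(1 <= b < m.+1) Num.sqrt (b%:R : R).
Proof.
case: m => [|m]; first by rewrite big_geq // !mul0r.
set s := Num.sqrt (m.+1%:R : R).
have s0 : 0 < s by rewrite sqrtr_gt0.
have s2 : s ^+ 2 = m.+1%:R by rewrite sqr_sqrtr.
have hs : \sum_(1 <= b < m.+2) (b%:R : R) >= m.+1%:R * m.+1%:R / 2.
  elim: (m.+1) => [|n IH]; first by rewrite big_geq // !mul0r.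
  rewrite big_nat_recr //= -natr1; have : 0 <= n%:R :> R by []. nra.
rewrite -(ler_pM2r s0); apply: (@le_trans _ _ (\sum_(1 <= b < m.+2) (b%:R : R))).
  by apply: le_trans hs; rewrite -s2; nra.
rewrite mulr_suml; apply: ler_sum_nat => b /andP[_ bm].
rewrite -[leLHS](@sqr_sqrtr _ b%:R) // expr2 ler_wpM2l ?sqrtr_ge0 //.
by rewrite ler_wsqrtr // ler_nat.
Qed.

(** * The gap for a finite superposition *)

(** The power [n ^ (-3/2)], in a form on which [field] can work. *)
Definition wt (R : realType) (n : nat) : R := (n%:R * Num.sqrt n%:R)^-1.

Lemma wt_ge0 (R : realType) n : 0 <= wt R n.
Proof. by rewrite invr_ge0 mulr_ge0 ?sqrtr_ge0. Qed.

(** The inequality [slope_sum_le] weighted by [wt b * tail b] and summed over [b].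
    The coefficient of [block l J k ^ 3] is the sum of [sqrt b] over
    [b <= m = 2 ^ k * J], divided by [16 m], hence at least [sqrt m / 32]. *)
Lemma finite_gap (R : realType) (l : nat -> R) (J K N : nat) :
  (1 <= J)%N -> N = (2 ^ K * J)%N -> (forall M, (1 <= M)%N -> 0 <= l M) ->
  (forall M, (1 <= M < J)%N -> l M = 0) ->
  \sum_(1 <= b < N) wt R b * tail l N b *
     (\sum_(1 <= a < N) slope R b a * (tail l N a * tail l N (a + b)%N))
  + \sum_(0 <= k < K) Num.sqrt (2 ^ k * J)%:R / 32 * block l J k ^+ 3
  <= (\sum_(1 <= b < N) wt R b * tail l N b) * (\sum_(1 <= a < N) tail l N a ^+ 2)
     + tail l N 1 / 2 *
       (\sum_(1 <= b < N | (2 * J <= b)%N) tail l N b ^+ 2 / Num.sqrt b%:R).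
Proof.
move=> J1 NE l0 lJ; pose Y := tail l N; rewrite -/(Y 1%N).
have Y0 n : (1 <= n)%N -> 0 <= Y n by move=> n1; apply: tail_ge0.
have gain : \sum_(0 <= k < K) Num.sqrt (2 ^ k * J)%:R / 32 * block l J k ^+ 3
  <= \sum_(1 <= b < N) wt R b * Y b * (b%:R ^+ 2 / 8 * layerSum l N (gainKernel R b)).
  apply: (@le_trans _ _ (\sum_(1 <= b < N) Num.sqrt b%:R / 8 *
     \sum_(0 <= k < K) (b <= 2 ^ k * J)%N%:R * (block l J k ^+ 3 / (2 ^ k.+1 * J)%:R))).
    under [leRHS]eq_bigr do rewrite mulr_sumr.
    rewrite exchange_big /=; apply: ler_sum_nat => k /andP[_ kK].
    set m := (2 ^ k * J)%N.
    have m1 : (1 <= m)%N by rewrite muln_gt0 expn_gt0.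
    have mN : (m.+1 <= N)%N.
      rewrite NE; apply: leq_trans (_ : (2 ^ k.+1 * J <= _)%N); last first.
        by rewrite leq_mul2r leq_exp2l ?kK ?orbT.
      by rewrite expnS -mulnA -/m; lia.
    have B0 : 0 <= block l J k ^+ 3 by rewrite exprn_ge0 ?block_ge0.
    have -> : (2 ^ k.+1 * J)%:R = 2 * m%:R :> R by rewrite expnS -mulnA natrM.
    have m0 : 0 < m%:R :> R by rewrite ltr0n.
    rewrite (eq_bigr (fun b => (block l J k ^+ 3 / (16 * m%:R)) *
        ((b <= m)%N%:R * Num.sqrt b%:R))); last first.
      by move=> b _; rewrite -/m; field; rewrite gt_eqF.
    rewrite -mulr_sumr.
    have -> : \sum_(1 <= b < N) (b <= m)%N%:R * Num.sqrt b%:R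
        = \sum_(1 <= b < m.+1) Num.sqrt (b%:R : R).
      rewrite [RHS](big_nat_widen _ _ N) // [RHS]big_mkcond; apply: eq_bigr => b _.
      by rewrite ltnS; case: (b <= m)%N; rewrite ?mul1r ?mul0r.
    have := sum_sqrt_ge R m; set S := \sum_(_ <= _ < _) _ => hS.
    apply: le_trans (ler_wpM2l _ hS); last first.
      by rewrite divr_ge0 // mulr_ge0.
    by rewrite le_eqVlt; apply/orP; left; apply/eqP; field; rewrite gt_eqF.
  apply: ler_sum_nat => b /andP[b1 _].
  apply: (@le_trans _ _ (Num.sqrt b%:R / 8 * (Y b * layerSum l N (gainKernel R b)))).
    apply: ler_wpM2l; first by rewrite divr_ge0 ?sqrtr_ge0.
    by rewrite /Y NE; exact: block_cube_le.
  rewrite le_eqVlt; apply/orP; left; apply/eqP; rewrite /wt.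
  have b0 : 0 < b%:R :> R by rewrite ltr0n.
  have s0 : 0 < Num.sqrt b%:R :> R by rewrite sqrtr_gt0.
  have := @sqr_sqrtr R b%:R (ltW b0); move: s0; set s := Num.sqrt _ => s0 <-.
  by field; rewrite gt_eqF.
apply: le_trans (lerD (lexx _) gain) _; rewrite -big_split /=.
rewrite mulr_suml mulr_sumr [X in _ <= _ + X]big_mkcond -big_split /=.
apply: ler_sum_nat => b /andP[b1 _]; rewrite -mulrDr.
apply: le_trans (ler_wpM2l _ (slope_sum_le N b1 l0 lJ)) _.
  by rewrite mulr_ge0 ?wt_ge0 ?Y0.
rewrite mulrDr -/Y lerD2l; case: (2 * J <= b)%N; last by rewrite mul0r mulr0.
rewrite mul1r le_eqVlt; apply/orP; left; apply/eqP; rewrite /wt.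
have b0 : 0 < b%:R :> R by rewrite ltr0n.
have s0 : 0 < Num.sqrt b%:R :> R by rewrite sqrtr_gt0.
by field; rewrite !gt_eqF.
Qed.

Lemma xseqE (R : realType) (y : nat -> R) n : (1 <= n)%N -> xseq y n = wt R n * y n.
Proof.
move=> n1; rewrite /xseq /wt; congr (_ * _).
have n0 : 0 < n%:R :> R by rewrite ltr0n.
have -> : - (3 / 2) = - (1 + 2^-1) :> R by field.
rewrite powRN powRD; last by rewrite gt_eqF ?implybT.
by rewrite powRr1 ?(ltW n0) // powR12_sqrt ?(ltW n0).
Qed.

Definition cubic (R : realType) (x : nat -> R) (a b : nat) : R :=
  (a%:R + b%:R) * (a%:R ^+ 2 + a%:R * b%:R + b%:R ^+ 2) * x a * x b * x (a + b)%N.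

(** The identity behind the whole argument: with [c = a + b], both sides are
    [(a ^ 2 + a b + b ^ 2) / (a b sqrt (a b c))] times the values of [y], and
    [(a + b / 2) a + (b + a / 2) b] is that numerator. *)
Lemma cubic_split (R : realType) (y : nat -> R) a b : (1 <= a)%N -> (1 <= b)%N ->
  cubic (xseq y) a b = wt R b * y b * (slope R b a * (y a * y (a + b)%N))
                     + wt R a * y a * (slope R a b * (y b * y (b + a)%N)).
Proof.
move=> a1 b1; rewrite /cubic !xseqE ?addn_gt0 ?a1 // (addnC b a) /wt /slope natrD.
have a0 : 0 < a%:R :> R by rewrite ltr0n.
have b0 : 0 < b%:R :> R by rewrite ltr0n.
rewrite [b%:R + a%:R]addrC !sqrtrM ?(ltW a0) ?(ltW b0) //.
have := @sqr_sqrtr R _ (ltW a0); have := @sqr_sqrtr R _ (ltW b0).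
have := sqrtr_gt0 (a%:R : R); rewrite a0.
have := sqrtr_gt0 (b%:R : R); rewrite b0.
have := sqrtr_gt0 (a%:R + b%:R : R); rewrite addr_gt0 //.
move: (Num.sqrt _) (Num.sqrt _) (Num.sqrt _) => r s t r0 s0 t0 s2 t2.
rewrite -s2 -t2; field; rewrite !gt_eqF //.
by rewrite addr_gt0 ?exprn_gt0.
Qed.

Lemma sum_cubic (R : realType) (y : nat -> R) N :
  \sum_(1 <= a < N) \sum_(1 <= b < N) cubic (xseq y) a b
  = 2 * \sum_(1 <= b < N) wt R b * y b *
      (\sum_(1 <= a < N) slope R b a * (y a * y (a + b)%N)).
Proof.
under [in RHS]eq_bigr do rewrite mulr_sumr.
rewrite mulr_natl mulr2n [X in _ = X + _]exchange_big -big_split /=.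
apply: eq_big_nat => a /andP[a1 _]; rewrite -big_split /=.
by apply: eq_big_nat => b /andP[b1 _]; rewrite cubic_split.
Qed.

(** * Dyadic points and the truncations of y *)

Lemma tail_lambda (R : realType) (y : nat -> R) N n : (n <= N)%N ->
  tail (lambda y) N n = y n - y N.
Proof.
move=> nN; rewrite /tail (eq_bigr (fun M => - y M.+1 - - y M)).
  by rewrite telescope_sumr // opprK addrC.
by move=> M _; rewrite /lambda opprK addrC.
Qed.

Lemma blockL_diff (R : realType) (y : nat -> R) J k :
  blockL y J k = y (2 ^ k * J)%N - y (2 ^ k.+1 * J)%N.
Proof. by apply: tail_lambda; rewrite leq_mul2r leq_exp2l ?leqnSn ?orbT. Qed.

Lemma dyadic_cvgy (J : nat) : (1 <= J)%N -> (2 ^ k * J)%N @[k --> \oo] --> \oo.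
Proof.
move=> J1; apply/cvgnyPge => A; near=> k.
apply: leq_trans (_ : (k <= _)%N); first by near: k; exact: nbhs_infty_ge.
by apply: leq_trans (ltnW (ltn_expl k (ltnSn 1))) _; rewrite leq_pmulr.
Unshelve. all: by end_near. Qed.

(** Telescoping, as [1 / b ^ 2 <= 1 / (b - 1/2) - 1 / (b + 1/2)]. *)
Lemma sum_inv_sq_le (R : realType) (m N : nat) : (1 <= m)%N ->
  \sum_(m <= b < N) ((b%:R : R) ^+ 2)^-1 <= 2 / m%:R.
Proof.
move=> m1; have m0 : 1 <= m%:R :> R by rewrite ler1n.
case: (leqP m N) => mN; last by rewrite big_geq ?divr_ge0 // ltnW.
have h b : (1 <= b)%N ->
    ((b%:R : R) ^+ 2)^-1 <= - (b.+1%:R - 2^-1)^-1 - - (b%:R - 2^-1)^-1.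
  move=> b1; have b0 : 1 <= b%:R :> R by rewrite ler1n.
  rewrite -natr1 -subr_ge0.
  have -> : - (b%:R + 1 - 2^-1)^-1 - - (b%:R - 2^-1)^-1 - (b%:R ^+ 2)^-1
      = (b%:R ^+ 2 * (2 * b%:R - 1) * (2 * b%:R + 1))^-1 :> R.
    by field; rewrite !gt_eqF //; lra.
  by rewrite invr_ge0 !mulr_ge0 ?exprn_ge0 //; lra.
apply: (@le_trans _ _ (\sum_(m <= b < N)
    (- ((b.+1%:R : R) - 2^-1)^-1 - - (b%:R - 2^-1)^-1))).
  by apply: ler_sum_nat => b /andP[mb _]; apply: h; exact: leq_trans mb.
rewrite telescope_sumr // opprK.
have N0 : 1 <= N%:R :> R by rewrite ler1n; exact: leq_trans mN.
have : 0 <= ((N%:R : R) - 2^-1)^-1 by rewrite invr_ge0; lra.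
have : (m%:R - 2^-1 : R)^-1 <= 2 / m%:R.
  rewrite -[leRHS]invrK invf_div lef_pV2 ?posrE; [lra|lra|].
  by rewrite divr_gt0 //; lra.
lra.
Qed.

Lemma inv_sq_bound (R : realType) (u : nat -> R) (c : R) N : 0 <= c ->
  (forall b, (1 <= b)%N -> u b <= c / b%:R ^+ 2) -> \sum_(1 <= b < N) u b <= 2 * c.
Proof.
move=> c0 uc; apply: (@le_trans _ _ (c * \sum_(1 <= b < N) (b%:R ^+ 2)^-1)).
  by rewrite mulr_sumr; apply: ler_sum_nat => b /andP[b1 _]; exact: uc.
rewrite mulrC ler_wpM2r //; have := sum_inv_sq_le R N (m := 1) isT.
by rewrite divr1.
Qed.

(** * Sums over the positive integers and over pairs of them *)

Lemma nneseries_le_bound (R : realType) (u : nat -> R) (m : nat) (B : R) :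
  (forall n, (m <= n)%N -> 0 <= u n) ->
  (forall N, \sum_(m <= n < N) u n <= B) ->
  (\sum_(m <= n <oo) (u n)%:E <= B%:E)%E.
Proof.
move=> u0 uB; apply: lime_le.
  by apply: is_cvg_nneseries => n mn _; rewrite lee_fin u0.
by apply: nearW => N; rewrite sumEFin lee_fin.
Qed.

Lemma nneseries_ge_partial (R : realType) (u : nat -> R) (m N : nat) :
  (forall n, (m <= n)%N -> 0 <= u n) ->
  ((\sum_(m <= n < N) u n)%:E <= \sum_(m <= n <oo) (u n)%:E)%E.
Proof.
move=> u0; rewrite -sumEFin; apply: nneseries_lim_ge => n mn _.
by rewrite lee_fin u0.
Qed.

Lemma sum_seq_le_square (R : realType) (t : nat * nat -> R) (s : seq (nat * nat)) N :
  uniq s -> {in s, forall p, (1 <= p.1 < N)%N && (1 <= p.2 < N)%N} ->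
  (forall p, (1 <= p.1)%N -> (1 <= p.2)%N -> 0 <= t p) ->
  \sum_(p <- s) t p <= \sum_(1 <= a < N) \sum_(1 <= b < N) t (a, b).
Proof.
move=> us sN t0.
rewrite -[leRHS](big_allpairs (F := t)) [leRHS](bigID (mem s)) /=.
rewrite [X in _ <= X + _](_ : _ = \sum_(p <- s) t p); last first.
  rewrite -big_filter; apply/perm_big/uniq_perm => //.
    by rewrite filter_uniq // allpairs_uniq ?iota_uniq // => -[? ?] [? ?] _ _ [-> ->].
  case=> a b; rewrite mem_filter; case: (boolP ((a, b) \in s)) => //= abs.
  by have /andP[ha hb] := sN _ abs; rewrite allpairs_f ?mem_index_iota.
rewrite lerDl big_seq_cond; apply: sumr_ge0 => p /andP[/allpairsP[[a b] /= [ha hb ->]] _].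
by move: ha hb; rewrite !mem_index_iota => /andP[a1 _] /andP[b1 _]; exact: t0.
Qed.

Lemma esum_le_square_bound (R : realType) (t : nat * nat -> R) (B : R) :
  (forall p, (1 <= p.1)%N -> (1 <= p.2)%N -> 0 <= t p) ->
  (forall N, \sum_(1 <= a < N) \sum_(1 <= b < N) t (a, b) <= B) ->
  (\esum_(p in [set p : nat * nat | (1 <= p.1)%N /\ (1 <= p.2)%N]) (t p)%:E <= B%:E)%E.
Proof.
move=> t0 tB; apply: ge_ereal_sup => _ [A [Afin AS] <-].
rewrite fsbig_finite //= sumEFin lee_fin.
set s := finmap.enum_fset _.
pose N := (\max_(p <- s) (p.1 + p.2)).+1.
apply: le_trans (tB N); apply: sum_seq_le_square => //.
  exact: finmap.fset_uniq.
move=> p ps; have [p1 p2] : [set p : nat * nat | (1 <= p.1)%N /\ (1 <= p.2)%N] p.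
  by apply: AS; move: ps; rewrite /s in_fset_set // inE.
have := @leq_bigmax_seq _ s xpredT (fun p => p.1 + p.2)%N p ps isT.
rewrite p1 p2 /= /N !ltnS => h.
by rewrite (leq_trans _ h) ?leq_addr // (leq_trans _ h) ?leq_addl.
Qed.

Lemma xseq_ge0 (R : realType) (y : nat -> R) n : 0 <= y n -> 0 <= xseq y n.
Proof. by move=> y0; rewrite mulr_ge0 ?powR_ge0. Qed.

Lemma cubic_ge0 (R : realType) (x : nat -> R) a b :
  (forall n, (1 <= n)%N -> 0 <= x n) -> (1 <= a)%N -> (1 <= b)%N -> 0 <= cubic x a b.
Proof.
move=> x0 a1 b1; rewrite /cubic !mulr_ge0 ?x0 ?addr_ge0 ?exprn_ge0 ?mulr_ge0 //.
by rewrite addn_gt0 a1.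
Qed.

(** * Rapid decay, and the inequality for truncations *)

Section main.
Context (R : realType) (y : nat -> R) (J : nat).
Hypothesis y_ge0 : forall n, (1 <= n)%N -> 0 <= y n.
Hypothesis y_nonincr : forall m n, (1 <= m)%N -> (m <= n)%N -> y n <= y m.
Hypothesis y_cvg0 : y n @[n --> \oo] --> (0 : R).
Hypothesis J1 : (1 <= J)%N.
Hypothesis lambda0 : forall M, (1 <= M)%N -> (M < J)%N -> lambda y M = 0.
Hypothesis decay : forall k, blockL y J k.+1 <= 1 / 1900 * blockL y J k.

Lemma lambda_ge0 M : (1 <= M)%N -> 0 <= lambda y M.
Proof. by move=> M1; rewrite /lambda subr_ge0 y_nonincr. Qed.

Lemma dyadic_gt0 k : (1 <= 2 ^ k * J)%N.
Proof. by rewrite muln_gt0 expn_gt0. Qed.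

Lemma blockL_ge0 k : 0 <= blockL y J k.
Proof. exact: (block_ge0 k J1 lambda_ge0). Qed.

(** The sequence [2 z_(k+1) - z_k] with [z_k = y (2 ^ k * J)] is nondecreasing by
    the decay hypothesis and tends to [0], hence is nonpositive. *)
Lemma dyadic_le_blockL k : y (2 ^ k * J)%N <= 2 * blockL y J k.
Proof.
pose u k := 2 * y (2 ^ k.+1 * J)%N - y (2 ^ k * J)%N.
have u_nondec : nondecreasing_seq u.
  apply/nondecreasing_seqP => n; rewrite /u.
  have := decay n; have := blockL_ge0 n; rewrite !blockL_diff; lra.
have z0 : y (2 ^ k * J)%N @[k --> \oo] --> (0 : R).
  exact: cvg_comp (dyadic_cvgy J1) y_cvg0.
have u0 : u n @[n --> \oo] --> (0 : R).
  rewrite -[0]subr0 -[X in X - _](mulr0 2); apply: cvgB => //.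
  apply: cvgMr; have := z0; rewrite -(cvg_shiftS (fun k => y (2 ^ k * J)%N)); exact.
have := nondecreasing_cvgn_le u_nondec (cvgP _ u0) k.
by rewrite (cvg_lim _ u0) // /u blockL_diff; lra.
Qed.

(** One step: [z_(k+1) <= 2 L_(k+1) <= (2 / 1900) L_k <= z_k / 950]. *)
Lemma dyadic_decay k : y (2 ^ k * J)%N <= y J / 950 ^+ k.
Proof.
elim: k => [|k IH]; first by rewrite mul1n expr0 divr1.
rewrite exprSr invfM mulrA.
have := dyadic_le_blockL k.+1; have := decay k.
have := y_ge0 (dyadic_gt0 k.+1); have := blockL_diff y J k; lra.
Qed.

Lemma mul_y_le k b : (2 ^ k * J <= b)%N -> (b < 2 ^ k.+1 * J)%N ->
  b%:R * y b <= 2 * J%:R * y J / 475 ^+ k.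
Proof.
move=> kb bk.
have h1 : y b <= y J / 950 ^+ k.
  by apply: le_trans (dyadic_decay k); apply: y_nonincr => //; exact: dyadic_gt0.
have h2 : b%:R <= 2 ^+ k * (2 * J%:R) :> R.
  by rewrite mulrA -exprSr -natrX -natrM ler_nat ltnW.
have b1 : (1 <= b)%N by exact: leq_trans (dyadic_gt0 k) kb.
apply: (le_trans (ler_pM _ (y_ge0 b1) h2 h1)) => //.
have -> : 950 = 2 * 475 :> R by rewrite -natrM.
rewrite exprMn le_eqVlt; apply/orP; left; apply/eqP; field.
by rewrite !expf_eq0 !pnatr_eq0 !andbF.
Qed.

Lemma dyadic_index b : (J <= b)%N ->
  exists k, (2 ^ k * J <= b)%N && (b < 2 ^ k.+1 * J)%N.
Proof.
move=> Jb; exists (trunc_log 2 (b %/ J)).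
have h : (0 < b %/ J)%N by rewrite divn_gt0.
have := @trunc_log_bounds 2 _ (ltnSn 1) h.
by rewrite /= leq_divRL // ltn_divLR.
Qed.

Lemma yJ_ge0 : 0 <= y J. Proof. exact: y_ge0. Qed.

(** Beyond [2 * J] at least one factor [475] is available, and [2 / 475 < 1 / 225]. *)
Lemma mul_y_le_far b : (2 * J <= b)%N -> b%:R * y b <= J%:R * y J / 225.
Proof.
move=> Jb; have [|k /andP[kb bk]] := @dyadic_index b; first by lia.
apply: le_trans (mul_y_le kb bk) _.
case: k kb bk => [|k] kb bk; first by move: bk; rewrite expn1; lia.
have h : (475 ^+ k : R)^-1 <= 1.
  have p : 1 <= 475 :> R by rewrite ler1n.
  have p0 : 0 < 475 ^+ k :> R by exact: exprn_gt0 (lt_le_trans ltr01 p).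
  by rewrite invf_le1 // exprn_ege1.
have hJ : 0 <= J%:R * y J by rewrite mulr_ge0 ?yJ_ge0.
rewrite exprS invfM; move: h; set d := _^-1 => h.
have : J%:R * y J * (1 - d) >= 0 by rewrite mulr_ge0 // subr_ge0.
lra.
Qed.

Lemma y_const n : (1 <= n)%N -> (n <= J)%N -> y n = y J.
Proof.
move=> n1 nJ; apply/eqP; rewrite -subr_eq0 -tail_lambda //; apply/eqP.
rewrite /tail big_nat_cond big1 // => M /andP[/andP[nM MJ] _].
by apply: lambda0 => //; exact: leq_trans nM.
Qed.

Lemma mul_y_le_all b : (1 <= b)%N -> b%:R * y b <= 2 * J%:R * y J.
Proof.
move=> b1; case: (leqP (2 * J) b) => h.
  apply: le_trans (mul_y_le_far h) _.
  have hJ : 0 <= J%:R * y J by rewrite mulr_ge0 ?yJ_ge0.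
  lra.
apply: ler_pM => //; first exact: y_ge0.
  by rewrite -natrM ler_nat ltnW.
case: (leqP b J) => bJ; first by rewrite y_const.
by apply: y_nonincr => //; exact: ltnW.
Qed.

Lemma tail_lambda_bound N n : (1 <= n)%N -> 0 <= tail (lambda y) N n <= y n.
Proof.
move=> n1; rewrite tail_ge0 //=; last exact: lambda_ge0.
case: (leqP n N) => nN; last by rewrite /tail big_geq ?y_ge0 // ltnW.
by rewrite tail_lambda // lerBlDr lerDl y_ge0 // (leq_trans n1).
Qed.

(** Since [b * y b <= J * y J / 225], the terms are at most
    [(J * y J / 225) ^ 2 / (sqrt J * b ^ 2)], and [1 / b ^ 2] sums to at most [1 / J] over [b >= 2 * J]. *)
Lemma loss_le N :
  \sum_(1 <= b < N | (2 * J <= b)%N) tail (lambda y) N b ^+ 2 / Num.sqrt b%:R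
  <= Num.sqrt J%:R * (y J / 225) ^+ 2.
Proof.
have J0 : 0 < J%:R :> R by rewrite ltr0n.
have s0 : 0 < Num.sqrt J%:R :> R by rewrite sqrtr_gt0.
have s2 : Num.sqrt J%:R ^+ 2 = J%:R :> R by rewrite sqr_sqrtr ?ltW.
have -> : \sum_(1 <= b < N | (2 * J <= b)%N) tail (lambda y) N b ^+ 2 / Num.sqrt b%:R
    = \sum_(2 * J <= b < N) tail (lambda y) N b ^+ 2 / Num.sqrt b%:R.
  by rewrite [RHS](big_nat_widenl _ 1) //; lia.
apply: (@le_trans _ _ (\sum_(2 * J <= b < N)
   ((J%:R * y J / 225) ^+ 2 / Num.sqrt J%:R) * (b%:R ^+ 2)^-1)).
  apply: ler_sum_nat => b /andP[Jb _].
  have b1 : (1 <= b)%N by lia.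
  have b0 : 0 < b%:R :> R by rewrite ltr0n.
  have /andP[t0 ty] := tail_lambda_bound N b1.
  rewrite [leRHS]mulrAC; apply: ler_pM; rewrite ?sqr_ge0 ?invr_ge0 ?sqrtr_ge0 //.
    rewrite ler_pdivlMr ?exprn_gt0 // -exprMn lerXn2r //;
      rewrite ?nnegrE ?mulr_ge0 ?yJ_ge0 ?(ltW b0) //.
    apply: le_trans (mul_y_le_far Jb); rewrite mulrC.
    by apply: ler_wpM2l => //; exact: ltW.
  rewrite lef_pV2 ?posrE ?sqrtr_gt0 // ler_wsqrtr // ler_nat; lia.
rewrite -mulr_sumr.
have h2J : (1 <= 2 * J)%N by lia.
apply: le_trans (ler_wpM2l _ (sum_inv_sq_le R N h2J)) _.
  by rewrite divr_ge0 ?sqr_ge0 ?ltW.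
rewrite natrM le_eqVlt; apply/orP; left; apply/eqP.
by move: s0 s2; set s := Num.sqrt _ => s0 <-; field; rewrite gt_eqF.
Qed.

(** Of the gain [1/32] of each block, [1/600] is kept; in block [0] a further
    [1/100] pays for the loss, which is at most
    [sqrt J * y J ^ 3 / 800] with [y J <= 2 L_0]. *)
Lemma finite_bound K N : (1 <= K)%N -> N = (2 ^ K * J)%N ->
  (1 / 2) * (\sum_(1 <= a < N) \sum_(1 <= b < N) cubic (xseq (tail (lambda y) N)) a b)
  + Num.sqrt J%:R / 600 * (\sum_(0 <= k < K) 2 `^ (k%:R / 2) * blockL y J k ^+ 3)
  <= (\sum_(1 <= b < N) wt R b * y b) * (\sum_(1 <= a < N) y a ^+ 2).
Proof.
move=> K1 NE.
have lJ M : (1 <= M < J)%N -> lambda y M = 0 by move=> /andP[? ?]; exact: lambda0.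
have := finite_gap J1 NE lambda_ge0 lJ.
rewrite sum_cubic mulrA div1r mulVf // mul1r.
set S := \sum_(1 <= b < N) _ * _; set P := \sum_(0 <= k < K) _.
set Q := _ * \sum_(1 <= a < N) _; set T := \sum_(1 <= b < N | _) _ => hgap.
set s := Num.sqrt J%:R.
have s0 : 0 <= s by exact: sqrtr_ge0.
have N1 : (1 <= N)%N by rewrite NE dyadic_gt0.
have tb n : (1 <= n)%N -> _ := tail_lambda_bound N (n := n).
have loss : tail (lambda y) N 1 / 2 * T <= s / 100 * blockL y J 0 ^+ 3.
  have /andP[t0 ty] := tb 1%N isT; have yJ := yJ_ge0.
  have y1 : tail (lambda y) N 1 <= y J by rewrite -(y_const (n := 1)).
  have yL : y J <= 2 * blockL y J 0 by have := dyadic_le_blockL 0; rewrite mul1n.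
  apply: le_trans (ler_wpM2l _ (loss_le N)) _; first by rewrite divr_ge0.
  apply: (@le_trans _ _ (s / 800 * y J ^+ 3)).
    rewrite -/s.
    have : tail (lambda y) N 1 * (s * y J ^+ 2) <= y J * (s * y J ^+ 2).
      by rewrite ler_wpM2r // mulr_ge0 ?sqr_ge0.
    have : 0 <= s * y J ^+ 3 by rewrite mulr_ge0 ?exprn_ge0.
    by rewrite exprS; nra.
  have : y J ^+ 3 <= (2 * blockL y J 0) ^+ 3.
    by rewrite lerXn2r ?nnegrE ?(le_trans yJ yL).
  by move=> /(ler_wpM2l s0); rewrite exprMn; lra.
have gain : s / 600 * (\sum_(0 <= k < K) 2 `^ (k%:R / 2) * blockL y J k ^+ 3)
    + s / 100 * blockL y J 0 ^+ 3 <= P.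
  have termE k : Num.sqrt (2 ^ k * J)%:R = s * 2 `^ (k%:R / 2).
    rewrite natrM sqrtrM // mulrC; congr (_ * _).
    by rewrite natrX powRrM powR_mulrn // powR12_sqrt ?exprn_ge0.
  have L3 k : 0 <= blockL y J k ^+ 3 by rewrite exprn_ge0 ?blockL_ge0.
  rewrite /P (big_ltn K1) [X in _ <= X](big_ltn K1) mulrDr.
  rewrite addrAC; apply: lerD.
    rewrite termE mul0r powRr0 mulr1 mul1r -mulrDl.
    by apply: ler_wpM2r; [exact: L3 | lra].
  rewrite mulr_sumr; apply: ler_sum_nat => k _; rewrite termE mulrA.
  apply: ler_wpM2r; first exact: L3.
  have : 0 <= s * 2 `^ (k%:R / 2) by rewrite mulr_ge0 ?powR_ge0.
  lra.
have AE : Q <= (\sum_(1 <= b < N) wt R b * y b) * (\sum_(1 <= a < N) y a ^+ 2).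
  apply: ler_pM.
  - rewrite big_nat_cond; apply: sumr_ge0 => b /andP[/andP[b1 _] _].
    by have /andP[t0 _] := tb b b1; rewrite mulr_ge0 ?wt_ge0.
  - by apply: sumr_ge0 => a _; exact: sqr_ge0.
  - apply: ler_sum_nat => b /andP[b1 _].
    by have /andP[_ ty] := tb b b1; rewrite ler_wpM2l ?wt_ge0.
  - apply: ler_sum_nat => b /andP[b1 _].
    by have /andP[t0 ty] := tb b b1; rewrite lerXn2r ?nnegrE // y_ge0.
rewrite -/s in gain *; lra.
Qed.

(** * Passage to the limit *)

Lemma tail_cvg n :
  tail (lambda y) (2 ^ K * J) n @[K --> \oo] --> y n.
Proof.
have h : (y n - y (2 ^ K * J)%N) @[K --> \oo] --> y n.
  rewrite -[X in _ --> X]subr0; apply: cvgB; first exact: cvg_cst.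
  exact: cvg_comp (dyadic_cvgy J1) y_cvg0.
apply: cvg_trans h; apply: near_eq_cvg; near=> K.
rewrite tail_lambda //; near: K.
by have /cvgnyPge := dyadic_cvgy J1; apply.
Unshelve. all: by end_near. Qed.

Lemma sum_cubic_cvg M :
  \sum_(1 <= a < M) \sum_(1 <= b < M)
    cubic (xseq (tail (lambda y) (2 ^ K * J))) a b @[K --> \oo]
  --> \sum_(1 <= a < M) \sum_(1 <= b < M) cubic (xseq y) a b.
Proof.
have xc n : xseq (tail (lambda y) (2 ^ K * J)) n @[K --> \oo] --> xseq y n.
  by apply: cvgMr; exact: tail_cvg.
apply: cvg_big => [|a _]; first exact: add_continuous.
apply: cvg_big => [|b _]; first exact: add_continuous.
by rewrite /cubic; do 3! apply: cvgM => //; exact: cvg_cst.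
Qed.

Definition gainSum (K : nat) : R :=
  \sum_(0 <= k < K) 2 `^ (k%:R / 2) * blockL y J k ^+ 3.

Lemma gain_ge0 k : 0 <= 2 `^ (k%:R / 2) * blockL y J k ^+ 3.
Proof. by rewrite mulr_ge0 ?powR_ge0 ?exprn_ge0 ?blockL_ge0. Qed.

(** For a fixed square of indices and a fixed number of blocks, [finite_bound] holds
    for all large truncations, and both sides are sums of finitely many terms that
    converge as the truncation is removed. *)
Lemma partial_bound (alpha e : R) (M K : nat) :
  (forall N, \sum_(1 <= b < N) wt R b * y b <= alpha) ->
  (forall N, \sum_(1 <= a < N) y a ^+ 2 <= e) ->
  (1 / 2) * (\sum_(1 <= a < M) \sum_(1 <= b < M) cubic (xseq y) a b)
  + Num.sqrt J%:R / 600 * gainSum K <= alpha * e.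
Proof.
move=> hA hE; set g := _ * gainSum K.
have hc : ((1 / 2) * (\sum_(1 <= a < M) \sum_(1 <= b < M)
      cubic (xseq (tail (lambda y) (2 ^ k * J))) a b) + g) @[k --> \oo]
    --> (1 / 2) * (\sum_(1 <= a < M) \sum_(1 <= b < M) cubic (xseq y) a b) + g.
  by apply: cvgD; [apply: cvgMr; exact: sum_cubic_cvg | exact: cvg_cst].
rewrite -(cvg_lim _ hc) //; apply: limr_le; first exact: cvgP hc.
near=> k.
have MN : (M <= 2 ^ k * J)%N by near: k; have /cvgnyPge := dyadic_cvgy J1; apply.
have k1 : (1 <= k)%N by near: k; exact: nbhs_infty_ge.
have Kk : (K <= k)%N by near: k; exact: nbhs_infty_ge.
set N := (2 ^ k * J)%N in MN *.
have AE : (\sum_(1 <= b < N) wt R b * y b) * (\sum_(1 <= a < N) y a ^+ 2) <= alpha * e.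
  apply: ler_pM => //; last by apply: sumr_ge0 => a _; exact: sqr_ge0.
  rewrite big_nat_cond; apply: sumr_ge0 => b /andP[/andP[b1 _] _].
  by rewrite mulr_ge0 ?wt_ge0 ?y_ge0.
apply: le_trans AE.
apply: le_trans (finite_bound k1 (erefl N)).
have x0 n : (1 <= n)%N -> 0 <= xseq (tail (lambda y) N) n.
  by move=> n1; have /andP[t0 _] := tail_lambda_bound N n1; exact: xseq_ge0.
apply: lerD.
  apply: ler_wpM2l => //; have [M0|M1] := posnP M.
    rewrite M0 big_geq // big_nat_cond; apply: sumr_ge0 => a /andP[/andP[a1 _] _].
    rewrite big_nat_cond; apply: sumr_ge0 => b /andP[/andP[b1 _] _].
    exact: cubic_ge0.
  rewrite [leRHS](big_cat_nat (n := M)) //=; apply: ler_wpDr.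
    rewrite big_nat_cond; apply: sumr_ge0 => a /andP[/andP[a1 _] _].
    rewrite big_nat_cond; apply: sumr_ge0 => b /andP[/andP[b1 _] _].
    by apply: cubic_ge0 => //; exact: leq_trans a1.
  apply: ler_sum_nat => a /andP[a1 _].
  rewrite [leRHS](big_cat_nat (n := M)) //=; apply: ler_wpDr => //.
  rewrite big_nat_cond; apply: sumr_ge0 => b /andP[/andP[b1 _] _].
  by apply: cubic_ge0 => //; exact: leq_trans b1.
rewrite /g; apply: ler_wpM2l; first exact: divr_ge0 (sqrtr_ge0 _) (ler0n _ _).
rewrite /gainSum [leRHS](big_cat_nat (n := K)) //=; apply: ler_wpDr => //.
by apply: sumr_ge0 => i _; exact: gain_ge0.
Unshelve. all: by end_near. Qed.

Lemma y_le_inv b : (1 <= b)%N -> y b <= 2 * J%:R * y J / b%:R.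
Proof.
move=> b1; rewrite ler_pdivlMr ?ltr0n // mulrC.
exact: mul_y_le_all.
Qed.

Lemma sum_wt_y_le N : \sum_(1 <= b < N) wt R b * y b <= 2 * (2 * J%:R * y J).
Proof.
have yJ := y_ge0 J1.
apply: inv_sq_bound => [|b b1]; first by rewrite !mulr_ge0.
have b0 : 1 <= b%:R :> R by rewrite ler1n.
rewrite expr2 invfM mulrC mulrA.
apply: ler_pM; rewrite ?y_ge0 ?wt_ge0 ?y_le_inv //.
have s1 : 1 <= Num.sqrt b%:R :> R by rewrite -[leLHS]sqrtr1 ler_wsqrtr.
by rewrite /wt lef_pV2 ?posrE; [nra | nra | lra].
Qed.

Lemma sum_y_sq_le N : \sum_(1 <= b < N) y b ^+ 2 <= 2 * (2 * J%:R * y J) ^+ 2.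
Proof.
apply: inv_sq_bound => [|b b1]; first exact: sqr_ge0.
rewrite -expr_div_n lerXn2r ?nnegrE ?y_ge0 ?y_le_inv //.
by rewrite divr_ge0 ?mulr_ge0 ?y_ge0.
Qed.
End main.

Unset Implicit Arguments.
Theorem theorem3p29 (R : realType) (y : nat -> R) (J0 : nat)
  (y_ge0 : forall n, (1 <= n)%N -> 0 <= y n)
  (y_nonincr : forall m n, (1 <= m)%N -> (m <= n)%N -> y n <= y m)
  (y_cvg0 : y n @[n --> \oo] --> (0 : R))
  (J0_ge1 : (1 <= J0)%N)
  (lambda0 : forall M, (1 <= M)%N -> (M < J0)%N -> lambda y M = 0)
  (blockL_decay : forall k, blockL y J0 k.+1 <= 1 / 1900 * blockL y J0 k) :
  [/\ (sumA (xseq y) < +oo)%E,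
      (sumE3 (xseq y) < +oo)%E,
      ~ (forall n, (1 <= n)%N -> y n = 0) ->
        (sumC (xseq y) < 2%:E * (sumA (xseq y) * sumE3 (xseq y)))%E
    & ((Num.sqrt (J0%:R : R) / 600)%:E *
         \sum_(0 <= k <oo) (2 `^ (k%:R / 2) * blockL y J0 k ^+ 3)%:E
       <= sumA (xseq y) * sumE3 (xseq y) - (1 / 2)%:E * sumC (xseq y))%E].
Proof.
have x0 n : (1 <= n)%N -> 0 <= xseq y n by move=> n1; apply/xseq_ge0/y_ge0.
have sumA_E N : \sum_(1 <= n < N) xseq y n = \sum_(1 <= n < N) wt R n * y n.
  by apply: eq_big_nat => n /andP[n1 _]; rewrite xseqE.
have sumE_E N : \sum_(1 <= n < N) n%:R ^+ 3 * xseq y n ^+ 2 = \sum_(1 <= n < N) y n ^+ 2.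
  apply: eq_big_nat => n /andP[n1 _]; rewrite xseqE // /wt.
  have n0 : 0 < n%:R :> R by rewrite ltr0n.
  have s0 : 0 < Num.sqrt n%:R :> R by rewrite sqrtr_gt0.
  have := @sqr_sqrtr R _ (ltW n0); move: s0; set s := Num.sqrt _ => s0 <-.
  by field; rewrite gt_eqF.
have e0 n : (1 <= n)%N -> 0 <= n%:R ^+ 3 * xseq y n ^+ 2.
  by move=> _; apply: mulr_ge0; [exact: exprn_ge0 | exact: sqr_ge0].
have Afin : (sumA (xseq y) < +oo)%E.
  apply: le_lt_trans (ltry (2 * (2 * J0%:R * y J0))).
  by apply: nneseries_le_bound => // N; rewrite sumA_E; exact: sum_wt_y_le.
have Efin : (sumE3 (xseq y) < +oo)%E.
  apply: le_lt_trans (ltry (2 * (2 * J0%:R * y J0) ^+ 2)).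
  by apply: nneseries_le_bound => // N; rewrite sumE_E; exact: sum_y_sq_le.
have [alpha Aalpha] : exists alpha, sumA (xseq y) = alpha%:E.
  exists (fine (sumA (xseq y))); rewrite fineK // ge0_fin_numE //.
  by apply: nneseries_ge0 => n n1 _; rewrite lee_fin x0.
have [e Ee] : exists e, sumE3 (xseq y) = e%:E.
  exists (fine (sumE3 (xseq y))); rewrite fineK // ge0_fin_numE //.
  by apply: nneseries_ge0 => n n1 _; rewrite lee_fin e0.
have hA N : \sum_(1 <= b < N) wt R b * y b <= alpha.
  by rewrite -sumA_E -lee_fin -Aalpha; exact: nneseries_ge_partial.
have hE N : \sum_(1 <= a < N) y a ^+ 2 <= e.
  by rewrite -sumE_E -lee_fin -Ee; exact: nneseries_ge_partial.
have s0 : 0 < Num.sqrt (J0%:R : R) / 600.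
  by apply: divr_gt0; rewrite ?sqrtr_gt0 ltr0n.
have c0 (p : nat * nat) : (1 <= p.1)%N -> (1 <= p.2)%N -> 0 <= cubic (xseq y) p.1 p.2.
  by move=> ? ?; exact: cubic_ge0.
have Cle K : (sumC (xseq y)
    <= (2 * (alpha * e - Num.sqrt J0%:R / 600 * gainSum y J0 K))%:E)%E.
  apply: (esum_le_square_bound (t := fun p => cubic (xseq y) p.1 p.2)) => // N /=.
  have := partial_bound y_ge0 y_nonincr y_cvg0 J0_ge1 lambda0 blockL_decay N K hA hE.
  lra.
have [c Cc] : exists c, sumC (xseq y) = c%:E.
  exists (fine (sumC (xseq y))); rewrite fineK // ge0_fin_numE.
    exact: le_lt_trans (Cle 0%N) (ltry _).
  by apply: esum_ge0 => p [p1 p2]; rewrite lee_fin; exact: c0.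
have gap K : gainSum y J0 K <= (alpha * e - 1 / 2 * c) / (Num.sqrt J0%:R / 600).
  by rewrite ler_pdivlMr // mulrC; have := Cle K; rewrite Cc lee_fin; lra.
have L0 k := blockL_ge0 y_nonincr J0_ge1 k.
rewrite Aalpha Ee Cc; split; [exact: ltry | exact: ltry | |].
- move=> ynz; rewrite -!EFinM lte_fin.
  suff L00 : 0 < blockL y J0 0.
    have := gap 1%N; rewrite /gainSum big_nat1 mul0r powRr0 mul1r ler_pdivlMr //.
    have : 0 < blockL y J0 0 ^+ 3 * (Num.sqrt J0%:R / 600) by rewrite mulr_gt0 ?exprn_gt0.
    lra.
  rewrite lt_neqAle L0 andbT; apply/eqP => L00; apply: ynz => n n1.
  have := dyadic_le_blockL y_nonincr y_cvg0 J0_ge1 blockL_decay 0.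
  rewrite mul1n -L00 mulr0 => yJ; apply/le_anti/andP; split; last exact: y_ge0.
  apply: le_trans yJ; case: (leqP n J0) => nJ; first by rewrite (y_const lambda0).
  by apply: y_nonincr => //; exact: ltnW.
- rewrite -!EFinM -EFinB.
  have h : (\sum_(0 <= k <oo) (2 `^ (k%:R / 2) * blockL y J0 k ^+ 3)%:E
      <= ((alpha * e - 1 / 2 * c) / (Num.sqrt J0%:R / 600))%:E)%E.
    by apply: nneseries_le_bound => // k _; exact: gain_ge0.
  apply: le_trans (lee_wpmul2l _ h) _; first by rewrite lee_fin ltW.
  by rewrite -EFinM lee_fin mulrC (divfK (lt0r_neq0 s0)).
Qed.
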